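(* Let $\mathcal{G}=(\mathcal{V},\mathcal{E})$ be a simple graph on $n$ nodes with Laplacian matrix $L_{\mathcal{G}}$, let $i\neq j$ be two nodes of $\mathcal{G}$, and let $r$ be a nonnegative integer. Then for every positive integer $k\le 2r+1$ the following hold. (Addition) If $(i,j)\notin\mathcal{E}$, then $$m_k\left(L_{\mathcal{G}+(i,j)}\right)-m_k\left(L_{\mathcal{G}}\right)=\frac{1}{n}\left(\mathrm{Trace}\left[\left(U_{r,(i,j)}^{+}\right)^{k}\right]-\mathrm{Trace}\left[\left(U_{r,(i,j)}\right)^{k}\right]\right).$$ (Deletion) If $(i,j)\in\mathcal{E}$, then $$m_k\left(L_{\mathcal{G}-(i,j)}\right)-m_k\left(L_{\mathcal{G}}\right)=\frac{1}{n}\left(\mathrm{Trace}\left[\left(U_{r,(i,j)}^{-}\right)^{k}\right]-\mathrm{Trace}\left[\left(U_{r,(i,j)}\right)^{k}\right]\right).$$ Here $U_{r,(i,j)}=L_{\mathcal{G}}(\mathcal{N}_{i,r}\cup\mathcal{N}_{j,r})$, $U_{r,(i,j)}^{+}=L_{\mathcal{G}+(i,j)}(\mathcal{N}_{i,r}\cup\mathcal{N}_{j,r})$ and $U_{r,(i,j)}^{-}=L_{\mathcal{G}-(i,j)}(\mathcal{N}_{i,r}\cup\mathcal{N}_{j,r})$.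
   Context: A simple graph $\mathcal{G}=(\mathcal{V},\mathcal{E})$ is finite, undirected, unweighted and has no self-loops. Its Laplacian matrix is $L_{\mathcal{G}}=D_{\mathcal{G}}-A_{\mathcal{G}}$, where $A_{\mathcal{G}}$ is the adjacency matrix and $D_{\mathcal{G}}=\mathrm{diag}(d_i)$ is the diagonal matrix of node degrees. If $\lambda_1,\dots,\lambda_n$ are the eigenvalues of $L_{\mathcal{G}}$ (with multiplicity), the $k$-th Laplacian spectral moment is $m_k(L_{\mathcal{G}})=\frac{1}{n}\sum_{i=1}^n\lambda_i^k$. $\mathcal{G}+(i,j)$ (resp. $\mathcal{G}-(i,j)$) denotes the simple graph on the same node set obtained by adding (resp. removing) the edge $(i,j)$ to (resp. from) $\mathcal{G}$. Let $\delta(i,j)$ be the graph distance in $\mathcal{G}$, i.e. the minimum length of a walk from $i$ to $j$, with $\delta(i,i)=0$, and let $\mathcal{N}_{i,r}=\{v\in\mathcal{V}:\delta(i,v)\le r\}$; the sets $\mathcal{N}_{i,r},\mathcal{N}_{j,r}$ are always taken with respect to the original graph $\mathcal{G}$. For a graph $\mathcal{F}$ on the node set $\mathcal{V}$ and $\mathcal{K}\subseteq\mathcal{V}$, $L_{\mathcal{F}}(\mathcal{K})$ denotes the submatrix of $L_{\mathcal{F}}$ formed by the rows and columns indexed by $\mathcal{K}$ (so its diagonal entries are degrees in the whole graph $\mathcal{F}$). *)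

(* Defs.v *)
From HB Require Import structures.
From mathcomp Require Import all_boot all_order all_algebra.

Set Implicit Arguments.
Unset Strict Implicit.
Unset Printing Implicit Defensive.

Import GRing.Theory Num.Theory.

Local Open Scope ring_scope.

Record sgraph (n : nat) := SGraph {
  edge :> rel 'I_n;
  edge_sym : symmetric edge;
  edge_irr : irreflexive edge
}.

Section Graph.
Variables (n : nat) (G : sgraph n).

Definition add_edge_rel (i j : 'I_n) : rel 'I_n :=
  fun u v => [|| G u v, (u == i) && (v == j) | (u == j) && (v == i)].

Lemma add_edge_sym i j : symmetric (add_edge_rel i j).
Proof.
move=> u v; rewrite /add_edge_rel edge_sym; congr (_ || _).
by rewrite orbC [(v == i) && _]andbC [(v == j) && _]andbC.
Qed.

Lemma add_edge_irr i j : i != j -> irreflexive (add_edge_rel i j).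
Proof.
move=> ij u; rewrite /add_edge_rel edge_irr /= [(u == j) && _]andbC orbb.
by case: eqP => //= ->; apply: negbTE.
Qed.

Definition add_edge (i j : 'I_n) (ij : i != j) : sgraph n :=
  SGraph (@add_edge_sym i j) (add_edge_irr ij).

Definition del_edge_rel (i j : 'I_n) : rel 'I_n :=
  fun u v => G u v && ~~ ((u == i) && (v == j) || (u == j) && (v == i)).

Lemma del_edge_sym i j : symmetric (del_edge_rel i j).
Proof.
move=> u v; rewrite /del_edge_rel edge_sym; congr (_ && ~~ _).
by rewrite orbC [(v == i) && _]andbC [(v == j) && _]andbC.
Qed.

Lemma del_edge_irr i j : irreflexive (del_edge_rel i j).
Proof. by move=> u; rewrite /del_edge_rel edge_irr. Qed.

Definition del_edge (i j : 'I_n) : sgraph n :=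
  SGraph (@del_edge_sym i j) (@del_edge_irr i j).

Definition walk (u v : 'I_n) (l : nat) : bool :=
  [exists p : l.-tuple 'I_n, path G u p && (last u p == v)].

Lemma connect_walk u v : connect G u v -> exists l, walk u v l.
Proof.
case/connectP=> p Gp ->; exists (size p); apply/existsP; exists (in_tuple p).
by rewrite Gp eqxx.
Qed.

(* [None] stands for an infinite distance. *)
Definition dist (u v : 'I_n) : option nat :=
  if decP (@idP (connect G u v)) is left uv then Some (ex_minn (connect_walk uv))
  else None.

Definition ball (u : 'I_n) (r : nat) : {set 'I_n} :=
  [set v | if dist u v is Some d then (d <= r)%N else false].

Definition degree (u : 'I_n) : nat := #|[set v | G u v]|.

End Graph.

Definition adjacency (C : pzRingType) (n : nat) (G : sgraph n) : 'M[C]_n :=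
  \matrix_(u, v) (G u v)%:R.

Definition laplacian (C : pzRingType) (n : nat) (G : sgraph n) : 'M[C]_n :=
  diag_mx (\row_u (degree G u)%:R) - adjacency C G.

Definition principal_submx (C : Type) (n : nat) (A : 'M[C]_n)
    (K : {set 'I_n}) : 'M[C]_#|K| :=
  mxsub (@enum_val _ (mem K)) (@enum_val _ (mem K)) A.

(* The roots of the characteristic polynomial, repeated according to their
   algebraic multiplicity. *)
Definition eigenvalues (C : closedFieldType) (n : nat) (A : 'M[C]_n) : seq C :=
  sval (closed_field_poly_normal (char_poly A)).

Definition spectral_moment (C : closedFieldType) (n : nat) (k : nat)
    (A : 'M[C]_n) : C :=
  n%:R^-1 * \sum_(x <- eigenvalues A) x ^+ k.

(* Main.v *)
(* The trace of [L ^+ k] counts weighted closed walks of length [k]. Adding or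
   deleting [(i, j)] only alters entries of [L] indexed by [i] and [j], so only
   closed walks through [i] or [j] change weight; as [k <= 2r + 1], each node of
   such a walk is within [r] steps of [{i, j}], so the walk stays in the
   neighbourhood on which the principal submatrices live. *)
Require Import Defs.
From HB Require Import structures.
From mathcomp Require Import all_boot all_order all_algebra.

Set Implicit Arguments.
Unset Strict Implicit.
Unset Printing Implicit Defensive.

Import GRing.Theory.

Local Open Scope ring_scope.

(** * Traces of powers and power sums of eigenvalues *)

(** Turning the factors [a] into [b] one at a time telescopes the difference without commutativity.
    The truncated [k.-1] is harmless at [k = 0], where the sum is empty. *)
Lemma subrXX_noncomm (R : pzRingType) (a b : R) (k : nat) :
  b ^+ k - a ^+ k = \sum_(t < k) b ^+ t * (b - a) * a ^+ (k.-1 - t).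
Proof.
elim: k => [|k IHk]; first by rewrite big_ord0 !expr0 subrr.
rewrite big_ord_recl expr0 mul1r subn0 /=.
transitivity ((b - a) * a ^+ k + b * (b ^+ k - a ^+ k)).
  by rewrite mulrBl mulrBr !exprS [RHS]addrC addrA subrK.
rewrite IHk mulr_sumr; congr (_ + _); apply: eq_bigr => t _.
rewrite exprS !mulrA /bump /= add1n; congr (_ * _ ^+ _).
by case: k t {IHk} => [[]|k] // t; rewrite subSS.
Qed.

Lemma trig_mulmx (R : pzSemiRingType) (n : nat) (A B : 'M[R]_n) :
  is_trig_mx A -> is_trig_mx B ->
  is_trig_mx (A *m B) /\ forall x, (A *m B) x x = A x x * B x x.
Proof.
move=> /is_trig_mxP A0 /is_trig_mxP B0; split.
  apply/is_trig_mxP => x y xy; rewrite mxE big1 // => z _.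
  case: (ltnP x z) => [xz|zx]; first by rewrite A0 ?mul0r.
  by rewrite B0 ?mulr0 // (leq_ltn_trans zx).
move=> x; rewrite mxE (bigD1 x) //= big1 ?addr0 // => z.
rewrite neq_ltn => /orP[zx|xz]; last by rewrite A0 ?mul0r.
by rewrite B0 ?mulr0.
Qed.

Lemma mxtrace_trigX (R : pzSemiRingType) (n k : nat) (A : 'M[R]_n) :
  is_trig_mx A -> \tr (A ^+ k) = \sum_x A x x ^+ k.
Proof.
move=> trA.
suff [_ AkE] : is_trig_mx (A ^+ k) /\ forall x, (A ^+ k) x x = A x x ^+ k.
  exact: eq_bigr.
elim: k => [|k [trAk AkE]].
  split=> [|x]; last by rewrite !expr0 mxE eqxx.
  by apply/is_trig_mxP => x y xy; rewrite expr0 mxE -val_eqE ltn_eqF.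
have [trAS ASE] := trig_mulmx trA trAk.
by rewrite exprS; split=> // x; rewrite ASE AkE exprS.
Qed.

Lemma char_poly_conj (R : comUnitRingType) (n : nat) (P A : 'M[R]_n) :
  P \in unitmx -> char_poly (P *m A *m invmx P) = char_poly A.
Proof.
move=> uP; rewrite /char_poly /char_poly_mx !map_mxM /=.
have PP : map_mx polyC P *m map_mx polyC (invmx P) = 1%:M.
  by rewrite -map_mxM mulmxV // map_mx1.
rewrite -[RHS]mul1r -(det1 _ n) -PP det_mulmx mulrAC -!det_mulmx.
rewrite mulmxBr mulmxBl scalar_mxC.
by rewrite -[_%:M *m _ *m _]mulmxA PP mulmx1.
Qed.

Lemma expr_conjmx (R : comUnitRingType) (n k : nat) (P A : 'M[R]_n) :
  P \in unitmx -> (P *m A *m invmx P) ^+ k = P *m (A ^+ k) *m invmx P.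
Proof.
move=> uP; elim: k => [|k IHk]; first by rewrite !expr0 mulmx1 mulmxV.
rewrite exprS IHk exprS -!mulmxE !mulmxA.
by rewrite mulmxKV.
Qed.

Lemma sum_eigenvaluesX (C : numClosedFieldType) (n k : nat) (A : 'M[C]_n) :
  \sum_(x <- eigenvalues A) x ^+ k = \tr (A ^+ k).
Proof.
(* Schur triangularisation, obtained as the simultaneous triangularisation of the commuting pair
   [A], [A]. *)
have [P /unitarymx_unit uP /andP[trA _]] := @cotrigonalization2 C n A A erefl.
set T := conjmx P A in trA; have TE : T = P *m A *m invmx P by apply: conjumx.
have -> : \tr (A ^+ k) = \tr (T ^+ k).
  by rewrite TE expr_conjmx // mxtrace_mulC mulmxA mulVmx // mul1mx.
(* Both products are the characteristic polynomial of [A]; unique factorisation makes the list of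
   eigenvalues a permutation of the diagonal of [T]. *)
have /prod_XsubC_eq eqT : \prod_(x <- eigenvalues A) ('X - x%:P)
    = \prod_(x <- [seq T x x | x <- index_enum 'I_n]) ('X - x%:P).
  rewrite big_map -char_poly_trig // TE char_poly_conj // /eigenvalues.
  case: closed_field_poly_normal => s /= /[dup] + ->.
  by rewrite (monicP (char_poly_monic A)) !scale1r.
by rewrite (perm_big _ eqT) /= big_map mxtrace_trigX.
Qed.

(** * Principal submatrices as compressions by a coordinate inclusion *)

Section PrincipalSubmatrix.
Variables (R : comPzRingType) (n : nat) (K : {set 'I_n}).
Implicit Types (M W : 'M[R]_n) (s : seq 'M[R]_n).

(** Its columns are the standard basis vectors indexed by [K], so it represents the inclusion of the
    coordinate subspace of [K]. *)
Definition incl_mx : 'M[R]_(n, #|K|) := colsub (@enum_val _ (mem K)) 1%:M.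

Lemma principal_submxE M :
  principal_submx M K = incl_mx^T *m M *m incl_mx.
Proof.
apply/matrixP => a b; rewrite !mxE (bigD1 (enum_val b)) //= big1 => [|x xb].
  rewrite !mxE eqxx mulr1 addr0 (bigD1 (enum_val a)) //= big1 => [|y ya].
    by rewrite !mxE eqxx mul1r addr0.
  by rewrite !mxE (negbTE ya) mul0r.
by rewrite 2![X in _ * X]mxE (negbTE xb) mulr0.
Qed.

Lemma principal_submx_tr M : principal_submx M^T K = (principal_submx M K)^T.
Proof. by rewrite /principal_submx trmx_mxsub. Qed.

(** [incl_mx *m incl_mx^T] is the diagonal projector onto the coordinates in [K], which fixes every
    row supported in [K]. *)
Lemma incl_mxK (m : nat) (V : 'M[R]_(m, n)) :
  (forall a x, V a x != 0 -> x \in K) -> V *m incl_mx *m incl_mx^T = V.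
Proof.
move=> VK; rewrite -mulmxA; apply/matrixP => a x; rewrite mxE.
rewrite (bigD1 x) //= big1 ?addr0 => [|y yx].
  case: (eqVneq (V a x) 0) => [->|/VK xK]; first by rewrite mul0r.
  rewrite mxE (bigD1 (enum_rank_in xK x)) //= big1 => [|b].
    by rewrite !mxE enum_rankK_in // eqxx mulr1 addr0 mulr1.
  rewrite !mxE; case: (x =P enum_val b) => [xb | _]; last by rewrite mul0r.
  by rewrite [X in enum_rank_in _ X]xb enum_valK_in eqxx.
rewrite mxE big1 ?mulr0 // => b _; rewrite !mxE.
by case: eqP => [<-|]; rewrite ?mul0r // eq_sym (negbTE yx) mulr0.
Qed.

End PrincipalSubmatrix.

Lemma trmx_prod (R : comPzRingType) (n : nat) (s : seq 'M[R]_n) :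
  (\prod_(M <- s) M)^T = \prod_(M <- rev [seq M^T | M <- s]) M.
Proof.
elim: s => [|M s IHs] /=; first by rewrite !big_nil trmx1.
by rewrite big_cons trmx_mul IHs rev_cons -cats1 big_cat big_seq1.
Qed.

(** * Matrix words along an increasing family of layers *)

Section Layers.
Variables (R : comPzRingType) (n : nat) (D : nat -> {set 'I_n}).
Hypothesis D_mono : forall s t, (s <= t)%N -> D s \subset D t.
Implicit Types (M W : 'M[R]_n) (s : seq 'M[R]_n).

(** With [M] read as a weighted digraph, one step climbs at most one layer. This abstracts the
    growth of balls around the modified pair. *)
Definition spreads M :=
  forall t x y, x \in D t -> M x y != 0 -> y \in D t.+1.

Lemma spreads_prod s u y :
  (forall M, M \in s -> spreads M) -> u \in D 0 ->
  (\prod_(M <- s) M) u y != 0 -> y \in D (size s).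
Proof.
elim/last_ind: s y => [|s M IHs] y sM uD.
  by rewrite big_nil mxE; case: (u =P y) => [<- //|_]; rewrite eqxx.
rewrite -cats1 big_cat big_seq1 /= size_cat addn1 mxE => nz.
have [z /andP[sz Mz]] : exists z, ((\prod_(M <- s) M) u z != 0) && (M z y != 0).
  apply/existsP; apply: contraR nz; rewrite negb_exists => /forallP nz.
  rewrite big1 // => z _; have := nz z; rewrite negb_and !negbK.
  by case/orP => /eqP->; rewrite ?mul0r ?mulr0.
apply: (sM M _ _ z) Mz; first by rewrite mem_rcons mem_head.
by apply: IHs sz => // N Ns; apply: sM; rewrite mem_rcons inE Ns orbT.
Qed.

Variable r : nat.
Local Notation J := (incl_mx R (D r)).
Local Notation sub M := (principal_submx M (D r)).

Lemma row_prod_incl s u :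
  (forall M, M \in s -> spreads M) -> u \in D 0 -> (size s <= r)%N ->
  row u ((\prod_(M <- s) M) *m J) = row u (J *m \prod_(M <- s) sub M).
Proof.
elim/last_ind: s => [|s M IHs] sM uD sr; first by rewrite !big_nil mul1mx mulmx1.
have sM' N : N \in s -> spreads N.
  by move=> Ns; apply: sM; rewrite mem_rcons inE Ns orbT.
have sr' : (size s <= r)%N by move: sr; rewrite size_rcons => /ltnW.
rewrite -cats1 !big_cat !big_seq1 /= -!mulmxE !mulmxA [RHS]row_mul -IHs //.
rewrite !row_mul principal_submxE !mulmxA incl_mxK //.
move=> a x; rewrite mxE => /(spreads_prod sM' uD).
exact/subsetP/D_mono.
Qed.

(* A word of length at most 2r splits into two halves of length at most r, the
   first never leaving [D r] when read from [u] and the second when read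
   backwards from [v]. *)
Lemma prod_principal_submx s u v :
  (forall M, M \in s -> spreads M /\ spreads M^T) -> (size s <= 2 * r)%N ->
  u \in D 0 -> v \in D 0 ->
  (\prod_(M <- s) M) u v = (J *m (\prod_(M <- s) sub M) *m J^T) u v.
Proof.
move=> sM sr uD vD.
have sM1 M : M \in take r s -> spreads M by move=> /mem_take /sM[].
have size1 : (size (take r s) <= r)%N by rewrite size_take_min geq_minl.
pose s2 := rev [seq M^T | M <- drop r s].
have sM2 M : M \in s2 -> spreads M.
  by rewrite mem_rev => /mapP[N /mem_drop /sM[_ spN] ->].
have size2 : (size s2 <= r)%N.
  by rewrite size_rev size_map size_drop leq_subLR addnn -mul2n.
have E1 := row_prod_incl sM1 uD size1.
have := row_prod_incl sM2 vD size2.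
rewrite -trmx_prod -[\prod_(M <- s2) sub M](big_map (fun M => sub M) xpredT id).
have -> : [seq sub M | M <- s2] = rev [seq N^T | N <- [seq sub M | M <- drop r s]].
  rewrite map_rev -!map_comp; congr rev.
  by apply: eq_map => M /=; rewrite principal_submx_tr.
rewrite -trmx_prod big_map => /(congr1 trmx).
rewrite !tr_row !trmx_mul !trmxK => E2.
(* At the junction of the two halves, at most [r] steps from [u], the walk is still in [D r], so the
   projector may be inserted there. *)
have EJ : row u (\prod_(M <- take r s) M) *m J *m J^T
    = row u (\prod_(M <- take r s) M).
  apply: incl_mxK => a x; rewrite mxE => /(spreads_prod sM1 uD).
  exact/subsetP/D_mono.
have mulE m (A : 'M[R]_(n, m)) B : (A *m B) u v = (row u A *m col v B) 0 0.
  by rewrite !mxE; apply: eq_bigr => x _; rewrite !mxE.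
have colM m p q (A : 'M[R]_(m, p)) (B : 'M_(p, q)) y :
    A *m col y B = col y (A *m B) by rewrite !colE mulmxA.
rewrite -{1 2}(cat_take_drop r s) !big_cat /= -!mulmxE mulE -EJ.
by rewrite -[row u _ *m J]row_mul E1 -mulmxA colM E2 -mulE !mulmxA.
Qed.

(* Telescoping and cyclicity of the trace reduce the claim to the traces of
   [(B - A) *m A ^+ a *m B ^+ b] with [a + b < k], where only the entries of the
   word indexed by [D 0] matter. *)
Lemma mxtrace_sub_principal_submx A B k :
  spreads A -> spreads A^T -> spreads B -> spreads B^T ->
  (forall x y, B x y != A x y -> (x \in D 0) && (y \in D 0)) ->
  (k <= 2 * r + 1)%N ->
  \tr (B ^+ k) - \tr (A ^+ k) = \tr (sub B ^+ k) - \tr (sub A ^+ k).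
Proof.
move=> spA spAt spB spBt AB kr; rewrite -!raddfB /= !subrXX_noncomm !raddf_sum.
apply: eq_bigr => t _ /=; pose s := nseq (k.-1 - t) A ++ nseq t B.
have prodE m (M N : 'M[R]_m) a b : M ^+ a * N ^+ b
    = \prod_(L <- nseq a M ++ nseq b N) L.
  by rewrite big_cat !big_nseq !iter_mulr_1.
rewrite -!mulmxE -!mulmxA mxtrace_mulC [RHS]mxtrace_mulC -!mulmxA.
rewrite !mulmxE prodE [in RHS]prodE -!mulmxE.
have subB : sub B - sub A = J^T *m (B - A) *m J.
  by rewrite !principal_submxE mulmxBr mulmxBl.
have -> : nseq (k.-1 - t) (sub A) ++ nseq t (sub B) = [seq sub M | M <- s].
  by rewrite map_cat !map_nseq.
(* Cycling [J^T] to the end leaves [B - A] against the compressed word [J *m _ *m J^T], which can be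
   compared with the full word entry by entry. *)
rewrite subB big_map -!mulmxA [RHS]mxtrace_mulC -!mulmxA.
apply: eq_bigr => x _; rewrite !mxE; apply: eq_bigr => y _.
case: (eqVneq (B x y) (A x y)) => [BA|/AB/andP[xD yD]].
  by rewrite !mxE BA subrr !mul0r.
congr (_ * _); rewrite mulmxA; apply: prod_principal_submx => //.
  by move=> M; rewrite mem_cat => /orP[] /nseqP[-> _].
(* One of the [k] factors is [B - A], so the remaining word has length [k.-1], at most [2 * r]. *)
rewrite size_cat !size_nseq subnK; first by rewrite -subn1 leq_subLR addnC.
by case: k t {s kr} => [[]|k] // t; rewrite -ltnS.
Qed.

End Layers.

(** * Balls described by walks of bounded length *)

Section Balls.
Variables (n : nat) (G : sgraph n).

Lemma ballP u v r :
  reflect (exists2 p, path G u p & last u p = v /\ (size p <= r)%N)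
          (v \in ball G u r).
Proof.
rewrite inE /dist; case: decP => [uv|nuv]; last first.
  apply: ReflectF => -[p Gp [pv _]].
  by apply: nuv; apply/connectP; exists p.
case: ex_minnP => m uvm m_min; apply: (iffP idP) => [mr|[q Gq [qv qr]]].
  case/existsP: uvm => p /andP[Gp /eqP pv].
  by exists p => //; rewrite size_tuple.
apply: leq_trans qr; apply: m_min; apply/existsP; exists (in_tuple q).
by rewrite Gq qv eqxx.
Qed.

Lemma ball0 u : ball G u 0 = [set u].
Proof.
apply/setP => v; rewrite in_set1; apply/ballP/eqP => [[[|w p]] //= _ []//|->].
by exists [::].
Qed.

Lemma subset_ball u r s : (r <= s)%N -> ball G u r \subset ball G u s.
Proof.
move=> rs; apply/subsetP => v /ballP[p Gp [pv pr]].
by apply/ballP; exists p => //; split=> //; apply: leq_trans rs.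
Qed.

Lemma ball_edge u v w r : v \in ball G u r -> G v w -> w \in ball G u r.+1.
Proof.
move=> /ballP[p Gp [pv pr]] vw; apply/ballP; exists (rcons p w).
  by rewrite rcons_path Gp pv.
by rewrite last_rcons size_rcons ltnS.
Qed.

End Balls.

(** * Laplacians of graphs that differ in one pair of nodes *)

Section Perturbation.
Variables (R : comPzRingType) (n : nat) (G H : sgraph n) (i j : 'I_n).

Definition ballU r := ball G i r :|: ball G j r.

(** Covers addition, deletion and the case [H = G] at once. *)
Definition agree_off_pair :=
  forall x y, H x y != G x y -> (x \in [set i; j]) && (y \in [set i; j]).

Lemma ballU0 : ballU 0 = [set i; j].
Proof. by rewrite /ballU !ball0. Qed.

Lemma subset_ballU s t : (s <= t)%N -> ballU s \subset ballU t.
Proof. by move=> st; rewrite setUSS ?subset_ball. Qed.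

Lemma trmx_laplacian : (laplacian R H)^T = laplacian R H.
Proof.
rewrite /laplacian raddfB /= tr_diag_mx; congr (_ - _).
by apply/matrixP => x y; rewrite !mxE edge_sym.
Qed.

(** The balls are those of [G] although the steps follow [H]: a diagonal entry stays put, an edge
    shared with [G] enlarges the radius by one, and an edge of [H] alone ends in [[set i; j]], which
    lies in every layer. *)
Lemma laplacian_spreads : agree_off_pair -> spreads ballU (laplacian R H).
Proof.
move=> HG t x y xD; rewrite !mxE; case: (eqVneq x y) => [<- _|xy].
  exact: subsetP (subset_ballU (leqnSn t)) _ xD.
rewrite mulr0n sub0r oppr_eq0.
case Hxy: (H x y); last by rewrite eqxx.
move=> _; case Gxy: (G x y).
  by move: xD; rewrite !in_setU => /orP[] /ball_edge/(_ Gxy) ->; rewrite ?orbT.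
have /andP[_] : (x \in [set i; j]) && (y \in [set i; j]).
  by apply: HG; rewrite Hxy Gxy.
by rewrite -ballU0; apply/subsetP/subset_ballU.
Qed.

Lemma laplacian_agree_off_pair x y : agree_off_pair ->
  laplacian R H x y != laplacian R G x y ->
  (x \in ballU 0) && (y \in ballU 0).
Proof.
move=> HG; rewrite ballU0; apply: contraNT => nxy.
have Hxy : H x y = G x y by apply: contraNeq nxy; apply: HG.
(* Only a diagonal entry can still differ. A node outside the pair has the same neighbours in both
   graphs, hence the same degree. *)
rewrite !mxE Hxy; case: (eqVneq x y) nxy => [<-|//]; rewrite andbb => xD.
suff -> : degree H x = degree G x by [].
apply: eq_card => z; rewrite !inE.
by apply: contraNeq xD => /HG/andP[].
Qed.

End Perturbation.

(** * Spectral moments under a change of one edge *)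

Lemma spectral_moment_perturb (C : numClosedFieldType) (n : nat)
    (G H : sgraph n) (i j : 'I_n) (r k : nat) :
  agree_off_pair G H i j -> (k <= 2 * r + 1)%N ->
  spectral_moment k (laplacian C H) - spectral_moment k (laplacian C G)
  = n%:R^-1 * (\tr (principal_submx (laplacian C H) (ballU G i j r) ^+ k)
               - \tr (principal_submx (laplacian C G) (ballU G i j r) ^+ k)).
Proof.
move=> HG kr; have GG : agree_off_pair G G i j by move=> x y; rewrite eqxx.
rewrite /spectral_moment !sum_eigenvaluesX -mulrBr; congr (_ * _).
(* Laplacians are symmetric, so the conditions on transposes reduce to the plain ones; [GG] supplies
   those for [G] itself. *)
apply: mxtrace_sub_principal_submx kr; rewrite ?trmx_laplacian.
- exact: subset_ballU.
- exact: laplacian_spreads.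
- exact: laplacian_spreads.
- exact: laplacian_spreads.
- exact: laplacian_spreads.
- by move=> x y; apply: laplacian_agree_off_pair.
Qed.

Lemma add_edge_agree_off_pair (n : nat) (G : sgraph n) (i j : 'I_n)
  (ij : i != j) : agree_off_pair G (add_edge G ij) i j.
Proof.
move=> x y; rewrite /= /add_edge_rel !inE.
by case: (G x y) => //; case: (x == i); case: (x == j); case: (y == i);
  case: (y == j).
Qed.

Lemma del_edge_agree_off_pair (n : nat) (G : sgraph n) (i j : 'I_n) :
  agree_off_pair G (del_edge G i j) i j.
Proof.
move=> x y; rewrite /= /del_edge_rel !inE.
by case: (G x y) => //; case: (x == i); case: (x == j); case: (y == i);
  case: (y == j).
Qed.

Theorem mainTheorem2 (C : numClosedFieldType) (n : nat) (G : sgraph n)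
    (i j : 'I_n) (ij : i != j) (r k : nat)
    (k_gt0 : (0 < k)%N) (k_le : (k <= 2 * r + 1)%N) :
  let K := ball G i r :|: ball G j r in
  let U := principal_submx (laplacian C G) K in
  let Uplus := principal_submx (laplacian C (add_edge G ij)) K in
  let Uminus := principal_submx (laplacian C (del_edge G i j)) K in
  (~~ G i j ->
     spectral_moment k (laplacian C (add_edge G ij))
       - spectral_moment k (laplacian C G)
     = n%:R^-1 * (\tr (Uplus ^+ k) - \tr (U ^+ k)))
  /\
  (G i j ->
     spectral_moment k (laplacian C (del_edge G i j))
       - spectral_moment k (laplacian C G)
     = n%:R^-1 * (\tr (Uminus ^+ k) - \tr (U ^+ k))).
Proof.
move=> K U Uplus Uminus; split=> _; apply: spectral_moment_perturb => //.
  exact: add_edge_agree_off_pair.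
exact: del_edge_agree_off_pair.
Qed.
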